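(* Let $n\ge 1$, and let $f,g\in\mathbb{C}[x_1,\ldots,x_n]$ be two weighted homogeneous polynomials of the same degree $d$ with respect to the same positive weights $(w_1,\ldots,w_n)$. Suppose that their Jacobian ideals in $\mathbb{C}[x_1,\ldots,x_n]$ coincide: $\mathcal{J}_f=\mathcal{J}_g$. Then $f$ and $g$ are right-equivalent ($\mathcal{R}$-equivalent), i.e. there exists a diffeomorphism $\psi:\mathbb{C}^n\to\mathbb{C}^n$ such that $f\circ\psi=g$.
   Context: Weights $w_1,\ldots,w_n$ are positive real numbers. A polynomial $f\in\mathbb{C}[x_1,\ldots,x_n]$, regarded as a function $f:(\mathbb{C}^n,0)\to(\mathbb{C},0)$ (so $f(0)=0$), is weighted homogeneous of degree $d$ with respect to the weights $(w_1,\ldots,w_n)$ if $f(\lambda^{w_1}x_1,\ldots,\lambda^{w_n}x_n)=\lambda^d f(x_1,\ldots,x_n)$ for all real $\lambda>0$; equivalently, every monomial $x_1^{k_1}\cdots x_n^{k_n}$ occurring in $f$ with nonzero coefficient satisfies $w_1k_1+\cdots+w_nk_n=d$. The Jacobian ideal of $f$ is $\mathcal{J}_f=\langle \partial f/\partial x_1,\ldots,\partial f/\partial x_n\rangle\subset\mathbb{C}[x_1,\ldots,x_n]$. The polynomials are arbitrary: no isolated-singularity assumption is made. ''Diffeomorphism'' is meant in the complex analytic sense, i.e. a biholomorphic map. *)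

(* Defs.v *)
From HB Require Import structures.
From mathcomp Require Import all_boot all_order all_algebra.
(* mpoly has to be imported before MathComp-Analysis: in the other order their
   notation levels conflict. *)
From mathcomp Require Import mpoly complex.
From mathcomp Require Import boolp classical_sets functions reals topology.
From mathcomp Require Import normedtype landau derive sequences exp.

Set Implicit Arguments.
Unset Strict Implicit.
Unset Printing Implicit Defensive.

Import Order.TTheory GRing.Theory Num.Theory.
Import numFieldNormedType.Exports.

Local Open Scope classical_set_scope.
Local Open Scope ring_scope.
Local Open Scope complex_scope.

(* MathComp-Analysis attaches the canonical norm and topology to the carrier of
   a numFieldType structure, not to the bare type R[i]; hence the ascription. *)
Definition Cplx (R : realType) : numClosedFieldType := R[i].

Definition mpoly_fun (K : comNzRingType) (n : nat) (f : {mpoly K[n]})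
  (x : 'rV[K]_n) : K := f.@[x ord0].

Definition weighted_homogeneous (R : realType) (n : nat) (w : 'I_n -> R)
    (d : R) (f : {mpoly (Cplx R)[n]}) : Prop :=
  forall (l : R) (x : 'rV[Cplx R]_n), 0 < l ->
    mpoly_fun f (\row_i (((l `^ w i)%:C : Cplx R) * x ord0 i)) =
    ((l `^ d)%:C : Cplx R) * mpoly_fun f x.

Definition ideal_gen (A : comNzRingType) (n : nat) (a : 'I_n -> A) : set A :=
  [set p | exists c : 'I_n -> A, p = \sum_(i < n) c i * a i].

Definition jacobian_ideal (K : comNzRingType) (n : nat) (f : {mpoly K[n]}) :
  set {mpoly K[n]} := ideal_gen (fun i => f^`M(i)).

(* The scalar field of both normed spaces is Cplx R, so the differential is
   required to be C-linear: this is complex differentiability on all of C^n. *)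
Definition holomorphic (R : realType) (m n : nat)
    (F : 'rV[Cplx R]_m -> 'rV[Cplx R]_n) : Prop :=
  forall x, differentiable F x.

Definition biholomorphic (R : realType) (n : nat)
    (F : 'rV[Cplx R]_n -> 'rV[Cplx R]_n) : Prop :=
  holomorphic F /\
  exists G : 'rV[Cplx R]_n -> 'rV[Cplx R]_n,
    [/\ holomorphic G, cancel F G & cancel G F].

Definition right_equivalent (R : realType) (n : nat)
    (f g : {mpoly (Cplx R)[n]}) : Prop :=
  exists psi : 'rV[Cplx R]_n -> 'rV[Cplx R]_n,
    biholomorphic psi /\ mpoly_fun f \o psi = mpoly_fun g.

(* Main.v *)
Require Import Defs.
From HB Require Import structures.
From mathcomp Require Import all_boot all_order all_algebra.
From mathcomp Require Import mpoly complex.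
From mathcomp Require Import boolp classical_sets functions reals topology.
From mathcomp Require Import normedtype landau derive sequences exp.

Import Order.TTheory GRing.Theory Num.Theory.
Import numFieldNormedType.Exports.

Set Implicit Arguments.
Unset Strict Implicit.
Unset Printing Implicit Defensive.

Local Open Scope ring_scope.

(** Write h = g - f and suppose first that d <> 0.  The proof shows that for all
    but finitely many complex numbers tau some polynomial automorphism of C^n
    carries f to f + tau h.  The hypotheses are symmetric in f and g, and
    g + (1 - tau) (f - g) is the same polynomial as f + tau h; a value of tau
    that is good for both sides links f to g through it.  (When d = 0, positive
    weights force f and g to be constant, hence zero.)

    The automorphism is first found over the ring C[[t]] of formal power series,
    for an indeterminate t in place of tau, by Moser's method.  By Euler's
    identity h lies in the Jacobian ideal of f, and the same holds for every k of
    degree d with J_k inside J_f; taking homogeneous parts, k = xi.f for a vector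
    field xi of weight 0.  Such a field maps J_f to itself, hence maps the space
    of those k to itself, so that the coefficients of a field X = sum t^m xi_m
    with X.(f + t h) = - h can be found one after the other
    ([vector_field_exists]).  The derivation Theta = d/dt + X then kills f + t h.
    A power series in t killed by Theta is determined by its constant term, and
    every polynomial p is the constant term of one; sending p to it is therefore
    a ring morphism, that is, a substitution x_i |-> phi_i, and it sends f to
    f + t h.  Since the weights are positive and X has weight 0, the phi_i have
    bounded degree in x, so they are polynomials over C[[t]], and the inverse
    substitution is polynomial for the same reason ([formal_deformation]).

    No convergence is needed to pass from t to a number tau.  That two
    substitutions are inverse to each other and carry f to f + t h is a system of
    polynomial relations between t and finitely many elements of the domain
    C[[t]].  When the coefficients are adjoined to C[t] one at a time, a ring
    morphism to C extends to the larger ring as soon as it does not kill a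
    certain nonzero element ([extend_point]), because C is algebraically closed.
    Hence the evaluation t := tau extends to all the coefficients for all but
    finitely many tau ([finite_specialization]), and the relations are
    preserved. *)

(** * Formal power series *)

(** A copy of [nat -> K], so that the convolution product does not clash with
    the pointwise one. *)
Definition fps (K : Type) := nat -> K.

HB.instance Definition _ (K : zmodType) := GRing.Zmodule.copy (fps K) (nat -> K).

Section FpsZmodule.
Variable U : zmodType.
Implicit Types a b : fps U.

Lemma coef_fps0 m : (0 : fps U) m = 0. Proof. by []. Qed.
Lemma coef_fpsD a b m : (a + b) m = a m + b m. Proof. by []. Qed.
Lemma coef_fpsN a m : (- a) m = - a m. Proof. by []. Qed.

Lemma coef_fps_sum I (r : seq I) (P : pred I) (A : I -> fps U) m :
  (\sum_(i <- r | P i) A i) m = \sum_(i <- r | P i) A i m.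
Proof. by elim/big_rec2: _ => // i y1 y2 _ <-. Qed.

End FpsZmodule.

Section FpsRing.
Variable K : comNzRingType.
Implicit Types a b c : fps K.

Definition fps_mul a b : fps K := fun m => \sum_(i < m.+1) a i * b (m - i)%N.
Definition fps_const (x : K) : fps K := fun m => if m is 0 then x else 0.

Let trunc N a : {poly K} := \poly_(i < N.+1) a i.

Let coef_trunc N a m : (m <= N)%N -> (trunc N a)`_m = a m.
Proof. by move=> mN; rewrite coef_poly ltnS mN. Qed.

(** The product can be computed on polynomial truncations, which reduces
    the ring axioms to those of polynomials. *)
Let fps_mulE N a b (p q : {poly K}) m : (m <= N)%N ->
  (forall j, (j <= N)%N -> p`_j = a j) -> (forall j, (j <= N)%N -> q`_j = b j) ->
  fps_mul a b m = (p * q)`_m.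
Proof.
move=> mN pa qb; rewrite coefM; apply: eq_bigr => i _.
rewrite pa ?qb //; first exact: leq_trans (leq_subr _ _) mN.
by apply: leq_trans mN; rewrite -ltnS.
Qed.

Fact fps_mulA : associative fps_mul.
Proof.
move=> a b c; apply/funext => m.
rewrite (@fps_mulE m a _ (trunc m a) (trunc m b * trunc m c)) //;
  try exact: coef_trunc; last first.
  by move=> j jm; rewrite -(@fps_mulE m b c) //; exact: coef_trunc.
rewrite (@fps_mulE m _ c (trunc m a * trunc m b) (trunc m c)) ?mulrA //;
  try exact: coef_trunc.
by move=> j jm; rewrite -(@fps_mulE m a b) //; exact: coef_trunc.
Qed.

Fact fps_mulC : commutative fps_mul.
Proof.
move=> a b; apply/funext => m.
rewrite (@fps_mulE m a b (trunc m a) (trunc m b)) 1?mulrC //;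
  try exact: coef_trunc.
by rewrite -(@fps_mulE m b a) //; exact: coef_trunc.
Qed.

Fact fps_constM x a : fps_mul (fps_const x) a = fun m => x * a m.
Proof.
apply/funext => m; rewrite /fps_mul big_ord_recl subn0 big1 ?addr0 //.
by move=> i _; rewrite mul0r.
Qed.

Fact fps_mul1 : left_id (fps_const 1) fps_mul.
Proof. by move=> a; rewrite fps_constM; apply/funext => m; rewrite mul1r. Qed.

Fact fps_mulDl : left_distributive fps_mul +%R.
Proof.
move=> a b c; apply/funext => m; rewrite /GRing.add /= /fps_mul -big_split.
by apply: eq_bigr => i _; rewrite mulrDl.
Qed.

Fact fps_oner_neq0 : fps_const 1 != 0 :> fps K.
Proof. by apply/eqP => /(congr1 (fun a => a 0%N)) /eqP; rewrite oner_eq0. Qed.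

HB.instance Definition _ := GRing.Zmodule_isComNzRing.Build (fps K)
  fps_mulA fps_mulC fps_mul1 fps_mulDl fps_oner_neq0.

Lemma coef_fpsM a b m : (a * b) m = \sum_(i < m.+1) a i * b (m - i)%N.
Proof. by []. Qed.
Lemma coef0_fpsM a b : (a * b) 0%N = a 0%N * b 0%N.
Proof. by rewrite coef_fpsM big_ord_recl big_ord0 addr0. Qed.
Lemma coef_fpsCM x a m : (fps_const x * a) m = x * a m.
Proof. by rewrite [_ * _]fps_constM. Qed.

End FpsRing.

(** Recursion on the coefficients: an operator whose m-th output coefficient only
    reads input coefficients of index < m is contracting, and the diagonal of its
    iterates is a fixed point. *)
Lemma fps_fixpoint (U : Type) (T : fps U -> fps U) :
  (forall a b m, (forall j, (j < m)%N -> a j = b j) -> T a m = T b m) ->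
  fps U -> exists a, T a = a.
Proof.
move=> Tloc u; pose v k : fps U := iter k T u.
have stable j : forall k, (j < k)%N -> v k.+1 j = v k j.
  elim/ltn_ind: j => j IH [//|k] jk; apply: Tloc => i ij.
  by apply: IH => //; apply: leq_trans ij _.
have vE j k : (j < k)%N -> v k j = v j.+1 j.
  elim: k => // k IH; rewrite ltnS leq_eqVlt => /predU1P[-> //|jk].
  by rewrite stable // IH.
exists (fun m => v m.+1 m); apply/funext => m.
by apply: Tloc => j jm; rewrite -[RHS]/(v m j) (vE j m jm).
Qed.

Section FpsDomain.
Variable K : idomainType.

Definition fps_unit : pred (fps K) := fun a => `[< exists b, b * a = 1 >].

Definition fps_inv (a : fps K) : fps K :=
  if pselect (exists b, b * a = 1) is left e then projT1 (cid e) else a.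

Fact fps_mulVr : {in fps_unit, left_inverse 1 fps_inv *%R}.
Proof.
move=> a /asboolP ua; rewrite /fps_inv; case: pselect => // e.
by case: (cid e).
Qed.

Fact fps_unitP a b : b * a = 1 -> a \in fps_unit.
Proof. by move=> ba; apply/asboolP; exists b. Qed.

Fact fps_inv_out : {in [predC fps_unit], fps_inv =1 id}.
Proof. by move=> a /asboolP ua; rewrite /fps_inv; case: pselect. Qed.

HB.instance Definition _ := GRing.ComNzRing_hasMulInverse.Build (fps K)
  fps_mulVr fps_unitP fps_inv_out.

Lemma fps_order (a : fps K) : a != 0 ->
  exists2 m, a m != 0 & forall j, (j < m)%N -> a j = 0.
Proof.
move=> aN0; have ex : exists m, a m != 0.
  apply: contrapT => a0; case/eqP: aN0; apply/funext => m; apply: contrapT => am.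
  by apply: a0; exists m; apply/eqP.
case: (ex_minnP ex) => m am min; exists m => // j.
by rewrite ltnNge; apply: contraNeq => /min.
Qed.

Fact fps_integral (a b : fps K) : a * b = 0 -> (a == 0) || (b == 0).
Proof.
move=> ab0; case: (eqVneq a 0) => //= /fps_order [i ai ia].
case: (eqVneq b 0) => //= /fps_order [j bj jb].
have /esym/eqP := congr1 (fun u : fps K => u (i + j)%N) ab0.
have i_ltn : (i < (i + j).+1)%N by rewrite ltnS leq_addr.
rewrite coef_fpsM (bigD1 (Ordinal i_ltn)) //= addKn big1 ?addr0.
  by rewrite eq_sym mulf_eq0 (negPf ai) (negPf bj).
move=> [l lij] /=; rewrite -val_eqE /= => li; case: (ltngtP l i) li => // [li|il] _.
  by rewrite ia ?mul0r.
rewrite jb ?mulr0 // ltn_subLR; first by rewrite ltn_add2r.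
by rewrite -ltnS.
Qed.

HB.instance Definition _ := GRing.ComUnitRing_isIntegral.Build (fps K)
  fps_integral.

End FpsDomain.

Section FpsMorphisms.
Variable K : comNzRingType.

Fact fps_const_additive : additive (@fps_const K).
Proof.
move=> x y; apply/funext => -[|m] //.
by rewrite coef_fpsD coef_fpsN /= subrr.
Qed.

Fact fps_const_multiplicative : multiplicative (@fps_const K).
Proof.
split=> // x y; apply/funext => -[|m]; rewrite coef_fpsCM //=.
by rewrite mulr0.
Qed.

HB.instance Definition _ := GRing.isAdditive.Build K (fps K) (@fps_const K)
  fps_const_additive.
HB.instance Definition _ := GRing.isMultiplicative.Build K (fps K) (@fps_const K)
  fps_const_multiplicative.

Definition fps_var : fps K := fun m => (m == 1%N)%:R.

Lemma coef_fps_varM a m : (fps_var * a) m = if m is m'.+1 then a m' else 0.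
Proof.
rewrite coef_fpsM big_ord_recl mul0r add0r; case: m => [|m].
  by rewrite big_ord0.
rewrite big_ord_recl mul1r subSS subn0 big1 ?addr0 // => i _.
by rewrite mul0r.
Qed.

Lemma coef_fps_var_poly (p : {poly K}) m :
  (map_poly (@fps_const K) p).[fps_var] m = p`_m.
Proof.
elim/poly_ind: p m => [|p c IH] m.
  by rewrite map_poly0 horner0 coef0.
rewrite rmorphD rmorphM /= map_polyX map_polyC hornerD hornerC hornerMX mulrC.
rewrite coef_fpsD coef_fps_varM coefD coefMX coefC.
by case: m => [|m] //=; rewrite IH.
Qed.

Lemma fps_var_transcendental (p : {poly K}) :
  (map_poly (@fps_const K) p).[fps_var] = 0 -> p = 0.
Proof. by move=> p0; apply/polyP => m; rewrite -coef_fps_var_poly p0 coef0. Qed.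

End FpsMorphisms.
Arguments fps_var {K}.

Section FpsMap.
Variables (K K' : comNzRingType) (f : {rmorphism K -> K'}).

Definition fps_map (a : fps K) : fps K' := fun m => f (a m).

Fact fps_map_additive : additive fps_map.
Proof. by move=> a b; apply/funext => m; rewrite /fps_map raddfB. Qed.

Fact fps_map_multiplicative : multiplicative fps_map.
Proof.
split=> [a b|]; apply/funext => m; last first.
  by case: m => [|m]; rewrite /fps_map ?rmorph1 ?rmorph0.
by rewrite /fps_map !coef_fpsM rmorph_sum; apply: eq_bigr => i _; rewrite rmorphM.
Qed.

HB.instance Definition _ := GRing.isAdditive.Build (fps K) (fps K') fps_map
  fps_map_additive.
HB.instance Definition _ := GRing.isMultiplicative.Build (fps K) (fps K') fps_map
  fps_map_multiplicative.
End FpsMap.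

(** * Specializing finitely many elements of a domain *)

Section ExtendPoint.
Variables (O : closedFieldType) (L : idomainType) (B : comNzRingType).
Variables (e : {rmorphism B -> L}) (c : L).
Implicit Types (p q m u w r : {poly B}).

(** Polynomials over B are only known through their images over the domain L;
    replacing one by a lift of minimal size makes its leading coefficient
    nonzero in L. *)
Lemma trim_poly p : exists2 q, map_poly e q = map_poly e p &
  size q = size (map_poly e p).
Proof.
pose q := \poly_(i < size (map_poly e p)) p`_i.
have qp : map_poly e q = map_poly e p.
  apply/polyP => i; rewrite coef_map /= /q coef_poly.
  by case: ltnP => lei; [rewrite coef_map | rewrite rmorph0 nth_default].
exists q; first exact: qp.
apply/eqP; rewrite eqn_leq size_poly /= -qp; exact: size_poly.
Qed.

Lemma pseudo_division p m : map_poly e m != 0 -> exists b u r,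
  [/\ e b != 0, e b *: map_poly e p = map_poly e u * map_poly e m + map_poly e r &
      (size (map_poly e r) < size (map_poly e m))%N].
Proof.
have [m' <- sz] := trim_poly m => m'N0.
have m'0 : m' != 0 by apply: contraNneq m'N0 => ->; rewrite map_poly0.
case: (Pdiv.ComRing.redivpP p m') => k u r E /(_ m'0) lt_r.
exists (lead_coef m' ^+ k), u, r; split; last 1 first.
- by rewrite sz in lt_r; apply: leq_ltn_trans lt_r; exact: size_poly.
- rewrite rmorphXn expf_eq0 negb_and lead_coefE.
  by apply/orP; right; rewrite sz -coef_map -lead_coefE lead_coef_eq0.
- by rewrite -map_polyZ E rmorphD rmorphM.
Qed.

Lemma min_size (P : {poly B} -> Prop) : (exists p, P p) ->
  exists2 p, P p &
    forall q, P q -> (size (map_poly e p) <= size (map_poly e q))%N.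
Proof.
move=> [p0 Pp0].
have ex : exists k, `[< exists2 p, P p & size (map_poly e p) = k >].
  by exists (size (map_poly e p0)); apply/asboolP; exists p0.
case: (ex_minnP ex) => k /asboolP [p Pp <-] kmin.
by exists p => // q Pq; apply: kmin; apply/asboolP; exists q.
Qed.

(** One step of the specialization.  The points z : B -> O that matter are those
    killing the kernel of e, i.e. the O-points of the subring e(B) of L; the
    lemma extends them to e(B)[c].  If c is transcendental over e(B), any y will
    do for which q does not vanish.  Otherwise y is a root of a relation m of
    minimal degree of c: outside the zeros of the leading coefficient of m,
    division by m shows that every relation of c holds at y.  Some
    multiple u(c) q(c) is a nonzero constant a of e(B); this equation persists at
    y, so that q(y) <> 0 as soon as z does not kill a. *)
Lemma extend_point q : (map_poly e q).[c] != 0 ->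
  exists2 q0 : B, e q0 != 0 &
    forall z : {rmorphism B -> O}, (forall b, e b = 0 -> z b = 0) ->
    z q0 != 0 -> exists2 y,
      forall p, (map_poly e p).[c] = 0 -> (map_poly z p).[y] = 0 &
      (map_poly z q).[y] != 0.
Proof.
move=> qc0.
have kill (z : {rmorphism B -> O}) p : (forall b, e b = 0 -> z b = 0) ->
    map_poly e p = 0 -> map_poly z p = 0.
  move=> zP p0; apply/polyP => i; rewrite coef_map coef0 /=; apply: zP.
  by rewrite -coef_map p0 coef0.
have [[m0 [m0c m00]]|trans] := pselect
    (exists m, (map_poly e m).[c] = 0 /\ map_poly e m != 0); last first.
  have tr p : (map_poly e p).[c] = 0 -> map_poly e p = 0.
    by move=> pc; apply: contrapT => /eqP p0; apply: trans; exists p.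
  exists q`_(size (map_poly e q)).-1.
    rewrite -coef_map -lead_coefE lead_coef_eq0.
    by apply: contraNneq qc0 => ->; rewrite horner0.
  move=> z zP zq.
  have /closed_nonrootP [y yP] : map_poly z q != 0.
    by apply: contraNneq zq => zq0; rewrite -coef_map zq0 coef0.
  by exists y => // p /tr /(kill z) -> //; rewrite horner0.
have [m [mc mN0] mmin] := min_size (ex_intro
  (fun m => (map_poly e m).[c] = 0 /\ map_poly e m != 0) m0 (conj m0c m00)).
have small r : (map_poly e r).[c] = 0 ->
    (size (map_poly e r) < size (map_poly e m))%N -> map_poly e r = 0.
  move=> rc; rewrite ltnNge => /negP rm; apply: contrapT => /eqP r0.
  by apply: rm; apply: mmin.
(* Multiples of q(c): one of minimal degree is a constant, for otherwise the
   division of m by it would produce a relation of c shorter than m. *)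
pose W w := (map_poly e w).[c] != 0 /\
  exists u, (map_poly e w).[c] = (map_poly e u).[c] * (map_poly e q).[c].
have [w [wc [u wu]] wmin] : exists2 w, W w &
    forall w', W w' -> (size (map_poly e w) <= size (map_poly e w'))%N.
  apply: min_size; exists q; split=> //; exists 1.
  by rewrite rmorph1 hornerC mul1r.
have wN0 : map_poly e w != 0.
  by apply: contraNneq wc => ->; rewrite horner0.
have w_m : (size (map_poly e w) < size (map_poly e m))%N.
  have [b [v [r [eb E lt_r]]]] := pseudo_division w mN0.
  apply: leq_ltn_trans lt_r; apply: wmin.
  have Er : (map_poly e r).[c] = e b * (map_poly e w).[c].
    have := congr1 (horner^~ c) E.
    by rewrite /= hornerZ hornerD hornerM mc mulr0 add0r.
  split; first by rewrite Er mulf_neq0.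
  exists (b *: u); rewrite Er wu map_polyZ hornerZ mulrA //.
have w_1 : size (map_poly e w) = 1%N.
  have [b [v [r [eb E lt_r]]]] := pseudo_division m wN0.
  have Ec : (map_poly e v).[c] * (map_poly e w).[c] = - (map_poly e r).[c].
    have := congr1 (horner^~ c) E.
    rewrite /= hornerZ hornerD hornerM mc mulr0 => /esym /eqP.
    by rewrite addr_eq0 => /eqP.
  have rc : (map_poly e r).[c] = 0.
    apply: contrapT => /eqP rc; have : W r.
      split=> //; exists (- (v * u)).
      by rewrite -[LHS]opprK -Ec wu rmorphN rmorphM hornerN hornerM mulrA mulNr.
    by move/wmin; rewrite leqNgt lt_r.
  have r0 := small r rc (ltn_trans lt_r w_m).
  have vc : (map_poly e v).[c] = 0.
    move: Ec; rewrite rc oppr0 => /eqP; rewrite mulf_eq0 (negPf wc) orbF.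
    by move/eqP.
  have vN0 : map_poly e v != 0.
    apply: contraNneq mN0 => v0; move/eqP: E.
    by rewrite v0 r0 mul0r addr0 scale_poly_eq0 (negPf eb).
  have := mmin v (conj vc vN0).
  have := congr1 (fun p : {poly L} => size p) E.
  rewrite /= r0 addr0 size_scale // size_mul // => ->.
  have := wN0; rewrite -size_poly_gt0; case: (size (map_poly e w)) => // a _.
  rewrite addnS /=.
  by rewrite -[leqRHS]addn0 leq_add2l leqn0 => /eqP ->.
have [w' ew' sw'] := trim_poly w.
have [m' em' sm'] := trim_poly m.
have w'E : w' = (w'`_0)%:P by apply: size1_polyC; rewrite sw' w_1.
have lm' : e (lead_coef m') != 0.
  by rewrite lead_coefE sm' -em' -coef_map -lead_coefE lead_coef_eq0 em'.
exists (w'`_0 * lead_coef m').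
  rewrite rmorphM mulf_neq0 //; move: wN0; rewrite -ew' w'E map_polyC.
  by rewrite polyC_eq0 coefC.
move=> z zP; rewrite rmorphM mulf_eq0 negb_or => /andP [zw zm].
have szm : size (map_poly z m') = size m' by rewrite size_poly_eq.
have [|y /rootP ym] := @closed_rootP O (map_poly z m') _.
  apply: contraTneq w_m; rewrite szm sm' => ->; rewrite w_1 //.
have van p : (map_poly e p).[c] = 0 -> (map_poly z p).[y] = 0.
  move=> pc; have m'N0 : map_poly e m' != 0 by rewrite em'.
  have m'0 : m' != 0 by apply: contraNneq m'N0 => ->; rewrite map_poly0.
  case: (Pdiv.ComRing.redivpP p m') => k v r E /(_ m'0) lt_r.
  have r0 : map_poly e r = 0.
    apply: small; last by rewrite -sm'; apply: leq_ltn_trans lt_r; exact: size_poly.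
    have := congr1 (fun p => (map_poly e p).[c]) E.
    rewrite /= map_polyZ hornerZ pc mulr0 rmorphD rmorphM hornerD hornerM /= em' mc.
    by rewrite mulr0 add0r.
  have := congr1 (fun p => (map_poly z p).[y]) E.
  rewrite /= map_polyZ hornerZ rmorphD rmorphM hornerD hornerM ym mulr0 add0r /=.
  rewrite (kill z r) // horner0 => /eqP; rewrite mulf_eq0 rmorphXn expf_eq0.
  by rewrite (negPf zm) andbF => /eqP.
exists y => //; apply: contraNneq zw => qy.
have : (map_poly z (w' - u * q)).[y] = 0.
  by apply: van; rewrite rmorphB rmorphM hornerD hornerN hornerM /= ew' wu subrr.
rewrite rmorphB rmorphM hornerD hornerN hornerM /= qy mulr0 subr0.
by rewrite w'E map_polyC hornerC coefC => ->.
Qed.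

End ExtendPoint.

(** B plays the part of the subring O[t, cs] of L.  The last clause speaks of an
    arbitrary b rather than of 1 so that the induction goes through:
    [extend_point] moves the condition b <> 0 down to the previous ring. *)
Lemma finite_specialization (O : closedFieldType) (L : idomainType)
    (k : {rmorphism O -> L}) (t : L) (cs : seq L) :
  (forall p, (map_poly k p).[t] = 0 -> p = 0) ->
  exists (B : comNzRingType) (e : {rmorphism B -> L})
      (i : {rmorphism {poly O} -> B}),
    [/\ forall p, e (i p) = (map_poly k p).[t],
        forall c, c \in cs -> exists b, e b = c &
        forall b, e b != 0 -> exists2 q : {poly O}, q != 0 &
          forall tau, q.[tau] != 0 -> exists z : {rmorphism B -> O},
            [/\ forall p, z (i p) = p.[tau],
                forall b', e b' = 0 -> z b' = 0 & z b != 0]].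
Proof.
move=> trans; elim: cs => [|c cs [B [e [i [ei ecs eP]]]]].
  exists {poly O}, (horner_eval t \o map_poly k), idfun; split=> // q.
  rewrite /= horner_evalE => qt; exists q.
    by apply: contraNneq qt => ->; rewrite map_poly0 horner0.
  move=> tau qtau; exists (horner_eval tau); split=> // p.
  by rewrite /= horner_evalE => /trans ->; rewrite horner_evalE horner0.
exists {poly B}, (horner_eval c \o map_poly e), (polyC \o i); split.
- by move=> p; rewrite /= horner_evalE map_polyC hornerC /= ei.
- move=> x; rewrite inE => /predU1P[->|/ecs[b eb]].
    by exists 'X; rewrite /= horner_evalE map_polyX hornerX.
  by exists b%:P; rewrite /= horner_evalE map_polyC hornerC.
move=> b; rewrite /= horner_evalE => /(extend_point O) [q0 /eP[q qN0 qP] q0P].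
exists q => // tau /qP [z [zi ze /(q0P z ze)[y yP yb]]].
exists (horner_eval y \o map_poly z); split=> [p|p|].
- by rewrite /= horner_evalE map_polyC hornerC /= zi.
- by rewrite /= !horner_evalE => /yP.
- by rewrite /= horner_evalE.
Qed.

Lemma comp_mpoly_sum (K : comNzRingType) n k (p : {mpoly K[n]})
    (s : n.-tuple {mpoly K[k]}) :
  p \mPo s = \sum_(m <- msupp p) p@_m *: ('X_[m] \mPo s).
Proof.
rewrite {1}[p]mpolyE (raddf_sum (comp_mpoly s)); apply: eq_bigr => m _ /=.
by rewrite comp_mpolyZ.
Qed.

Lemma comp_mpolyA (K : comNzRingType) n k l (p : {mpoly K[n]})
    (s : n.-tuple {mpoly K[k]}) (r : k.-tuple {mpoly K[l]}) :
  (p \mPo s) \mPo r = p \mPo map_tuple (comp_mpoly r) s.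
Proof.
rewrite [p \mPo s]comp_mpoly_sum (raddf_sum (comp_mpoly r)) [RHS]comp_mpoly_sum.
apply: eq_bigr => m _ /=; rewrite comp_mpolyZ !comp_mpolyX rmorph_prod.
by congr (_ *: _); apply: eq_bigr => i _; rewrite rmorphXn tnth_map.
Qed.

Section MapMpoly.
Variables (n : nat) (A K : comNzRingType) (e : {rmorphism A -> K}).

Lemma map_mpoly_comp_tuple k (p : {mpoly A[n]}) (s : n.-tuple {mpoly A[k]}) :
  map_mpoly e (p \mPo s) = map_mpoly e p \mPo map_tuple (map_mpoly e) s.
Proof.
rewrite comp_mpoly_sum raddf_sum [p in RHS]mpolyE (raddf_sum (map_mpoly e)).
rewrite (raddf_sum (comp_mpoly _)); apply: eq_bigr => m _ /=.
rewrite !map_mpolyZ comp_mpolyZ map_mpolyX !comp_mpolyX rmorph_prod.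
by congr (_ *: _); apply: eq_bigr => i _; rewrite rmorphXn tnth_map.
Qed.

Lemma lift_mpoly (p : {mpoly K[n]}) :
  (forall m, m \in msupp p -> exists b, e b = p@_m) ->
  exists q, map_mpoly e q = p.
Proof.
move=> ep; have /choice [b bP] m : exists b, m \in msupp p -> e b = p@_m.
  by case: (boolP (m \in msupp p)) => [/ep [b <-]|_]; [exists b | exists 0].
exists (\sum_(m <- msupp p) b m *: 'X_[m]).
rewrite [RHS]mpolyE (raddf_sum (map_mpoly e)) !big_seq; apply: eq_bigr => m /bP.
by rewrite /= map_mpolyZ map_mpolyX => ->.
Qed.

End MapMpoly.

Definition mpoly_inverse (K : comNzRingType) n (s s' : n.-tuple {mpoly K[n]}) :=
  forall i, tnth s i \mPo s' = 'X_i /\ tnth s' i \mPo s = 'X_i.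

(** Both substitutions have finitely many coefficients, so they lift to the ring B
    of [finite_specialization]; an identity between polynomials over B that
    holds over L also holds after any point of B that kills the kernel. *)
Lemma specialize_automorphism (O : closedFieldType) (L : idomainType)
    (k : {rmorphism O -> L}) (t : L) n (f h : {mpoly O[n]})
    (s s' : n.-tuple {mpoly L[n]}) :
  (forall p, (map_poly k p).[t] = 0 -> p = 0) ->
  mpoly_inverse s s' ->
  map_mpoly k f \mPo s = map_mpoly k f + t *: map_mpoly k h ->
  exists2 q : {poly O}, q != 0 & forall tau, q.[tau] != 0 ->
    exists r r', mpoly_inverse r r' /\ f \mPo r = f + tau *: h.
Proof.
move=> trans inv fs.
pose cs := flatten [seq [seq p@_m | m <- msupp p] | p : {mpoly L[n]} <- s ++ s'].
have [B [e [i [ei ecs eP]]]] := finite_specialization cs trans.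
have lift (p : {mpoly L[n]}) : p \in val s ++ val s' -> exists q, map_mpoly e q = p.
  move=> ps; apply: lift_mpoly => m mp; apply: ecs; apply/flattenP.
  exists [seq p@_m | m <- msupp p]; first by apply/mapP; exists p.
  by apply/mapP; exists m.
have lift_tuple (u : n.-tuple {mpoly L[n]}) : {subset u <= val s ++ val s'} ->
    exists v : n.-tuple {mpoly B[n]}, map_tuple (map_mpoly e) v = u.
  move=> us; have /choice [v vP] j : exists v, map_mpoly e v = tnth u j.
    by apply: lift; apply: us; exact: mem_tnth.
  exists (mktuple v); apply: eq_from_tnth => j.
  by rewrite tnth_map tnth_mktuple.
have [S eS] : exists v : n.-tuple {mpoly B[n]}, map_tuple (map_mpoly e) v = s.
  by apply: lift_tuple => p ps; rewrite mem_cat ps.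
have [S' eS'] : exists v : n.-tuple {mpoly B[n]}, map_tuple (map_mpoly e) v = s'.
  by apply: lift_tuple => p ps; rewrite mem_cat ps orbT.
have [|q qN0 qP] := eP 1; first by rewrite rmorph1 oner_neq0.
exists q => // tau /qP [z [zi ze _]].
have kill (p : {mpoly B[n]}) : map_mpoly e p = 0 -> map_mpoly z p = 0.
  move=> p0; apply/mpolyP => m; rewrite mcoeff_map_mpoly mcoeff0 /= ze //.
  by rewrite -mcoeff_map_mpoly p0 mcoeff0.
have zeq (p p' : {mpoly B[n]}) :
    map_mpoly e p = map_mpoly e p' -> map_mpoly z p = map_mpoly z p'.
  move=> pp'; apply/eqP; rewrite -subr_eq0 -raddfB; apply/eqP/kill.
  by rewrite raddfB /= pp' subrr.
pose jm (p : {mpoly O[n]}) : {mpoly B[n]} := map_mpoly (i \o polyC) p.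
have ejm (p : {mpoly O[n]}) : map_mpoly e (jm p) = map_mpoly k p.
  by apply/mpolyP => m; rewrite !mcoeff_map_mpoly /= ei map_polyC hornerC.
have zjm (p : {mpoly O[n]}) : map_mpoly z (jm p) = p.
  by apply/mpolyP => m; rewrite !mcoeff_map_mpoly /= zi hornerC.
exists (map_tuple (map_mpoly z) S), (map_tuple (map_mpoly z) S'); split.
  move=> j; rewrite !tnth_map -!map_mpoly_comp_tuple -(map_mpolyX z).
  have [ss' s's] := inv j.
  have Sj : map_mpoly e (tnth S j) = tnth s j by rewrite -eS tnth_map.
  have S'j : map_mpoly e (tnth S' j) = tnth s' j by rewrite -eS' tnth_map.
  by split; apply: zeq; rewrite map_mpoly_comp_tuple map_mpolyX ?eS ?eS' ?Sj ?S'j.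
rewrite -{1}(zjm f) -map_mpoly_comp_tuple.
have -> : f + tau *: h = map_mpoly z (jm f + i 'X *: jm h).
  by rewrite raddfD /= map_mpolyZ !zjm zi hornerX.
apply: zeq; rewrite map_mpoly_comp_tuple eS ejm fs raddfD /= map_mpolyZ !ejm.
by rewrite ei map_polyX hornerX.
Qed.

(** * Weighted homogeneous polynomials *)

Section WeightedHomogeneous.
Variables (K : comNzRingType) (n : nat) (S : zmodType) (w : 'I_n -> S).
Implicit Types (p q : {mpoly K[n]}) (d : S).

Definition mwt (m : 'X_{1..n}) : S := \sum_i w i *+ m i.

Lemma mwtD m1 m2 : mwt (m1 + m2) = mwt m1 + mwt m2.
Proof. by rewrite -big_split; apply: eq_bigr => i _; rewrite mnmDE mulrnDr. Qed.

Lemma mwt1 i : mwt U_(i) = w i.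
Proof.
rewrite /mwt (bigD1 i) //= mnm1E eqxx big1 ?addr0 // => j ji.
by rewrite mnm1E eq_sym (negPf ji).
Qed.

Definition whomog d p := forall m, p@_m != 0 -> mwt m = d.

Lemma whomog0 d : whomog d 0.
Proof. by move=> m; rewrite mcoeff0 eqxx. Qed.

Lemma whomogD d p q : whomog d p -> whomog d q -> whomog d (p + q).
Proof.
move=> hp hq m; rewrite mcoeffD => pqm; case: (eqVneq p@_m 0) => [p0|/hp //].
by apply: hq; apply: contraNneq pqm => ->; rewrite p0 addr0.
Qed.

Lemma whomogN d p : whomog d p -> whomog d (- p).
Proof. by move=> hp m; rewrite mcoeffN oppr_eq0 => /hp. Qed.

Lemma whomogZ d c p : whomog d p -> whomog d (c *: p).
Proof.
move=> hp m; rewrite mcoeffZ => cpm; apply: hp.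
by apply: contraNneq cpm => ->; rewrite mulr0.
Qed.

Lemma whomog_sum d I (r : seq I) (P : pred I) (G : I -> {mpoly K[n]}) :
  (forall i, P i -> whomog d (G i)) -> whomog d (\sum_(i <- r | P i) G i).
Proof.
by move=> hG; elim/big_rec: _ => [|i p /hG]; [exact: whomog0 | exact: whomogD].
Qed.

Lemma whomogM d d' p q : whomog d p -> whomog d' q -> whomog (d + d') (p * q).
Proof.
move=> hp hq m pqm; apply: contrapT => md; case/eqP: pqm.
rewrite mcoeffM big1 // => -[m1 m2] /= /eqP mE.
case: (eqVneq p@_m1 0) => [->|/hp m1d]; first by rewrite mul0r.
case: (eqVneq q@_m2 0) => [->|/hq m2d]; first by rewrite mulr0.
by case: md; rewrite mE mwtD m1d m2d.
Qed.

Lemma whomogX i : whomog (w i) 'X_i.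
Proof.
move=> m; rewrite mcoeffX; case: (U_(i)%MM =P m) => [<- _|_]; first exact: mwt1.
by rewrite eqxx.
Qed.

Lemma whomog_mderiv d i p : whomog d p -> whomog (d - w i) p^`M(i).
Proof.
move=> hp m; rewrite mcoeff_deriv => pm; rewrite -(hp (m + U_(i))%MM).
  by rewrite mwtD mwt1 addrK.
by apply: contraNneq pm => ->; rewrite mul0rn.
Qed.

End WeightedHomogeneous.

(** * The formal flow of a time-dependent vector field *)

Section Derivations.
Variables (K : comNzRingType) (n : nat).
Implicit Types (a b : fps {mpoly K[n]}).

Definition fps_dt a : fps {mpoly K[n]} := fun m => a m.+1 *+ m.+1.
Definition fps_dx (i : 'I_n) a : fps {mpoly K[n]} := fun m => (a m)^`M(i).

Lemma fps_dtM a b : fps_dt (a * b) = fps_dt a * b + a * fps_dt b.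
Proof.
apply/funext => m; rewrite /fps_dt coef_fpsD !coef_fpsM -sumrMnl.
transitivity (\sum_(i < m.+2) (a i *+ i * b (m.+1 - i)%N
                             + a i * (b (m.+1 - i)%N *+ (m.+1 - i)))).
  apply: eq_bigr => -[i im] _ /=; rewrite mulrnAl mulrnAr -mulrnDr.
  by rewrite subnKC.
rewrite big_split /=; congr (_ + _).
  rewrite big_ord_recl mulr0n mul0r add0r; apply: eq_bigr => i _.
  by rewrite subSS.
rewrite big_ord_recr /= subnn mulr0n mulr0 addr0; apply: eq_bigr => i _.
by rewrite subSn // -ltnS.
Qed.

Lemma fps_dxM i a b : fps_dx i (a * b) = fps_dx i a * b + a * fps_dx i b.
Proof.
apply/funext => m; rewrite /fps_dx coef_fpsD !coef_fpsM raddf_sum -big_split /=.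
by apply: eq_bigr => j _; rewrite mderivM.
Qed.

(** The derivation d/dt + X of K[x][[t]]; its kernel consists of the quantities that
    the flow of X transports. *)
Definition transport (X : 'I_n -> fps {mpoly K[n]}) a :=
  fps_dt a + \sum_i X i * fps_dx i a.

Variable X : 'I_n -> fps {mpoly K[n]}.

Lemma transportD a b : transport X (a + b) = transport X a + transport X b.
Proof.
rewrite /transport addrACA -big_split /=; congr (_ + _).
  by apply/funext => m; rewrite /fps_dt !coef_fpsD mulrnDl.
apply: eq_bigr => i _; rewrite -mulrDr; congr (_ * _).
by apply/funext => m; rewrite /fps_dx !coef_fpsD mderivD.
Qed.

Lemma transportM a b : transport X (a * b) = transport X a * b + a * transport X b.
Proof.
rewrite /transport fps_dtM mulrDl mulrDr addrACA; congr (_ + _).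
rewrite mulr_suml mulr_sumr -big_split /=; apply: eq_bigr => i _.
by rewrite fps_dxM mulrDr mulrA [X in _ + X]mulrCA.
Qed.

Lemma transport_const (c : K) : transport X (fps_const c%:MP) = 0.
Proof.
rewrite /transport big1 => [|i _]; last first.
  apply/funext => m; rewrite coef_fpsM big1 // => j _.
  rewrite /fps_dx; case: (m - j)%N => [|k] /=; last by rewrite mderiv0 mulr0.
  by rewrite mderivC mulr0.
by rewrite addr0; apply/funext => m; rewrite /fps_dt /= mul0rn.
Qed.

End Derivations.

Section Extension.
Variables (U : zmodType) (E : {additive U -> fps U}).
Implicit Types (a b : fps U).

(** For E : U -> U[[t]], this is the t-linear extension U[[t]] -> U[[t]],
    mapping sum a_j t^j to sum E(a_j) t^j.  If E is the identity modulo t, the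
    extension is bijective: this is how the flow is inverted. *)
Definition fps_extend a : fps U := fun m => \sum_(j < m.+1) E (a j) (m - j)%N.

Lemma fps_extendD a b : fps_extend (a + b) = fps_extend a + fps_extend b.
Proof.
apply/funext => m; rewrite coef_fpsD /fps_extend -big_split /=.
by apply: eq_bigr => j _; rewrite coef_fpsD raddfD coef_fpsD.
Qed.

Lemma fps_extend_const x :
  fps_extend (fun m => if m is 0%N then x else 0) = E x.
Proof.
apply/funext => m; rewrite /fps_extend big_ord_recl subn0 big1 ?addr0 // => j _.
by rewrite raddf0.
Qed.

Hypothesis E0 : forall x, E x 0%N = x.

Lemma fps_extend_recr a m :
  fps_extend a m = \sum_(j < m) E (a j) (m - j)%N + a m.
Proof. by rewrite /fps_extend big_ord_recr /= subnn E0. Qed.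

Lemma fps_extend_inj : injective fps_extend.
Proof.
move=> a b ab; apply/funext; elim/ltn_ind => m IH.
have := congr1 (fun c : fps U => c m) ab; rewrite /= !fps_extend_recr.
rewrite (eq_bigr (fun j : 'I_m => E (b j) (m - j)%N)) => [/addrI //|j _].
by rewrite IH.
Qed.

Lemma fps_extend_surj b : exists a, fps_extend a = b.
Proof.
pose T a : fps U := fun m => b m - \sum_(j < m) E (a j) (m - j)%N.
have [||a aT] := @fps_fixpoint _ T; [|exact: b|].
  move=> a c m ac; congr (_ - _); apply: eq_bigr => j _.
  by rewrite ac.
exists a; apply/funext => m; rewrite fps_extend_recr -[X in _ + X m]aT.
by rewrite addrC subrK.
Qed.

End Extension.

Section FormalFlow.
Variables (K : numFieldType) (n : nat) (S : zmodType) (w : 'I_n -> S).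
Variable X : 'I_n -> fps {mpoly K[n]}.
Local Notation M := {mpoly K[n]}.
Implicit Types (a b : fps M).

Definition fps_whomog d a := forall m, whomog w d (a m).

Lemma transport_rec a m : transport X a = 0 ->
  a m.+1 = - ((m.+1)%:R^-1 *: (\sum_i X i * fps_dx i a) m).
Proof.
move=> a0; have := congr1 (fun b : fps M => b m) a0.
rewrite /transport coef_fpsD /fps_dt coef_fps0 => /eqP.
rewrite addr_eq0 => /eqP E; rewrite -scalerN -E -[X in _ *: X]scaler_nat scalerA.
by rewrite mulVf ?scale1r // pnatr_eq0.
Qed.

Lemma eq_coef_advection m a b : (forall j, (j <= m)%N -> a j = b j) ->
  (\sum_i X i * fps_dx i a) m = (\sum_i X i * fps_dx i b) m.
Proof.
move=> ab; rewrite !coef_fps_sum; apply: eq_bigr => i _.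
rewrite !coef_fpsM; apply: eq_bigr => j _; congr (_ * _).
by rewrite /fps_dx ab // leq_subr.
Qed.

(** The equation transport X a = 0 reads (m+1) a_(m+1) = - (X.a)_m, where the
    right-hand side only involves a_0, ..., a_m. *)
Lemma transport_uniq a b : transport X a = 0 -> transport X b = 0 ->
  a 0%N = b 0%N -> a = b.
Proof.
move=> Xa Xb ab0; apply/funext; elim/ltn_ind => -[|m] IH //.
rewrite (transport_rec m Xa) (transport_rec m Xb); congr (- (_ *: _)).
by apply: eq_coef_advection => j jm; apply: IH.
Qed.

Lemma transport_exists (p : M) : exists2 a, transport X a = 0 & a 0%N = p.
Proof.
pose T a : fps M := fun m =>
  if m is m'.+1 then - ((m'.+1)%:R^-1 *: (\sum_i X i * fps_dx i a) m') else p.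
have [||a aT] := @fps_fixpoint _ T; [|exact: 0|].
  move=> a b [|m] // ab; congr (- (_ *: _)).
  by apply: eq_coef_advection => j jm; apply: ab.
exists a; last by rewrite -aT.
apply/funext => m; rewrite /transport coef_fpsD /fps_dt -[in X in X + _]aT /=.
by rewrite mulNrn -scaler_nat scalerA mulfV ?pnatr_eq0 // scale1r addNr.
Qed.

Hypothesis X_whomog : forall i, fps_whomog (w i) (X i).

(** X has weight 0: its i-th component has the weight w i that differentiation by
    x_i removes. *)
Lemma transport_whomog d a : transport X a = 0 -> whomog w d (a 0%N) ->
  fps_whomog d a.
Proof.
move=> Xa a0; elim/ltn_ind => -[|m] IH //; rewrite (transport_rec m Xa).
apply/whomogN/whomogZ; rewrite coef_fps_sum; apply: whomog_sum => i _.
rewrite coef_fpsM; apply: whomog_sum => j _.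
rewrite -[d](subrK (w i)) addrC; apply: whomogM; first exact: X_whomog.
by apply: whomog_mderiv; apply: IH; rewrite ltnS leq_subr.
Qed.

Hypothesis bounded : forall i, exists D, forall m, mwt w m = w i -> (mdeg m < D)%N.

(** Polynomials over K[[t]] as power series in t with polynomial coefficients.
    The image consists of the series whose coefficients have bounded degree. *)
Definition embed : {mpoly (fps K)[n]} -> fps M :=
  mmap (fps_map (@mpolyC n K)) (fun i => fps_const 'X_i).
HB.instance Definition _ := GRing.RMorphism.on embed.

Lemma coef_embed p m u : (embed p m)@_u = p@_u m.
Proof.
rewrite [p]mpolyE (raddf_sum embed) coef_fps_sum !raddf_sum coef_fps_sum.
apply: eq_bigr => v _ /=; rewrite mcoeffZ mcoeffX.
rewrite /embed mmapZ mmapX /mmap1.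
under eq_bigr do rewrite -rmorphXn.
rewrite -rmorph_prod mulrC coef_fpsCM mulrC -mpolyXE_id /= /fps_map mcoeffCM mcoeffX.
by rewrite mulrC; case: eqP => _; rewrite ?mulr1 ?mulr0 ?mul1r ?mul0r.
Qed.

Lemma embed_inj : injective embed.
Proof.
move=> p q pq; apply/mpolyP => u; apply/funext => m.
by rewrite -!coef_embed pq.
Qed.

Lemma embed_surj i a : fps_whomog (w i) a -> exists p, embed p = a.
Proof.
move=> ha; have [D bD] := bounded i.
exists (\sum_(u : 'X_{1..n < D}) ((fun m => (a m)@_u) : fps K) *: 'X_[u]).
apply/funext => m; apply/mpolyP => u; rewrite coef_embed.
have [uD|Du] := ltnP (mdeg u) D.
  by rewrite (mcoeff_mpoly (fun u => ((fun m => (a m)@_u) : fps K))).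
rewrite raddf_sum coef_fps_sum big1 => [|v _].
  apply/esym/eqP; apply: contraTT Du => /(ha m) /bD; by rewrite ltnNge.
rewrite /= mcoeffZ mcoeffX; case: eqP => [vu|_]; last by rewrite mulr0.
by move: (bmdeg v); rewrite vu ltnNge Du.
Qed.

Lemma flow_exists : exists phi : 'I_n -> fps M,
  forall i, transport X (phi i) = 0 /\ phi i 0%N = 'X_i.
Proof.
have /choice [phi phiP] i : exists a, transport X a = 0 /\ a 0%N = 'X_i.
  by have [a Xa a0] := transport_exists 'X_i; exists a.
by exists phi.
Qed.

Variable phi : 'I_n -> fps M.
Hypothesis Xphi : forall i, transport X (phi i) = 0.
Hypothesis phi0 : forall i, phi i 0%N = 'X_i.

(** Substitution of the flow phi.  It is the unique section of the constant term
    with values in the kernel of [transport X]. *)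
Definition pull : M -> fps M := mmap (@fps_const M \o @mpolyC n K) phi.
HB.instance Definition _ := GRing.RMorphism.on pull.

(** The kernel of a derivation is a subring, and it contains the phi i. *)
Lemma transport_pull p : transport X (pull p) = 0.
Proof.
have T0 : transport X 0 = 0.
  by have := transport_const X 0; rewrite mpolyC0 raddf0.
have T1 : transport X 1 = 0.
  by have := transport_const X 1; rewrite mpolyC1 rmorph1.
have TM a b : transport X a = 0 -> transport X b = 0 -> transport X (a * b) = 0.
  by rewrite transportM => -> ->; rewrite mul0r mulr0 addr0.
rewrite /pull /mmap; elim/big_rec: _ => // m a _ Xa.
rewrite transportD Xa addr0 TM ?transport_const // /mmap1.
elim/big_rec: _ => // i b _ Xb; apply: (TM) => //.
by elim: (m i) => [|k IH]; rewrite ?expr0 // exprS TM.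
Qed.

Lemma coef0_pull p : pull p 0%N = p.
Proof.
rewrite [RHS]mpolyE /pull /mmap coef_fps_sum; apply: eq_bigr => m _.
rewrite coef_fpsCM mul_mpolyC mpolyXE_id; congr (_ *: _).
rewrite /mmap1; elim/big_rec2: _ => // i p1 a _ <-.
rewrite coef0_fpsM; congr (_ * _); elim: (m i) => // k IH.
by rewrite !exprS coef0_fpsM IH phi0.
Qed.

Lemma coef_pullZX c u j : pull (c *: 'X_[u]) j = c *: mmap1 phi u j.
Proof. by rewrite /pull mmapZ mmapX /= coef_fpsCM mul_mpolyC. Qed.

Local Notation pull_ext := (fps_extend pull).

Lemma whomog_pull_ext d a : fps_whomog d (pull_ext a) -> fps_whomog d a.
Proof.
move=> ha; elim/ltn_ind => m IH.
rewrite -[a m](addKr (\sum_(j < m) pull (a j) (m - j)%N)) -(fps_extend_recr coef0_pull).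
apply: whomogD => //; apply: whomogN; apply: whomog_sum => j _.
apply: transport_whomog; first exact: transport_pull.
by rewrite coef0_pull; apply: IH.
Qed.

(** On polynomials over K[[t]] the t-linear extension of [pull] is again the
    substitution of phi. *)
Lemma pull_ext_embed p :
  pull_ext (embed p) = mmap (fps_map (@mpolyC n K)) phi p.
Proof.
have T0 : pull_ext 0 = 0.
  by apply: (addrI (pull_ext 0)); rewrite -fps_extendD !addr0.
have -> : pull_ext (embed p) =
    \sum_(u <- msupp p) pull_ext (embed (p@_u *: 'X_[u])).
  rewrite {1}[p]mpolyE (raddf_sum embed).
  by elim/big_rec2: _ => // u a b _ <-; rewrite fps_extendD.
rewrite [RHS]/mmap; apply: eq_bigr => u _.
have eE j : embed (p@_u *: 'X_[u]) j = p@_u j *: 'X_[u].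
  apply/mpolyP => v; rewrite coef_embed !mcoeffZ !mcoeffX.
  by case: eqP; rewrite ?mulr1 ?mulr0.
apply/funext => m; rewrite coef_fpsM /fps_extend; apply: eq_bigr => j _.
by rewrite eE /= coef_pullZX /fps_map mul_mpolyC.
Qed.

Lemma embed_const p : embed (map_mpoly (@fps_const K) p) = fps_const p.
Proof.
apply/funext => m; apply/mpolyP => u; rewrite coef_embed mcoeff_map_mpoly.
by case: m => [|m] //=; rewrite mcoeff0.
Qed.

(** The inverse s' consists of the preimages of the variables under the t-linear
    extension of [pull]; these have bounded degree because [pull] preserves
    weights.  This makes s' a one-sided inverse only; the other identity follows
    because substituting s is injective. *)
Lemma formal_automorphism : exists s s' : n.-tuple {mpoly (fps K)[n]},
  mpoly_inverse s s' /\
  forall p, embed (map_mpoly (@fps_const K) p \mPo s) = pull p.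
Proof.
have /choice [s sE] i : exists p, embed p = phi i.
  apply: (@embed_surj i); apply: transport_whomog => //.
  by rewrite phi0; exact: whomogX.
have /choice [s' s'E] i : exists p, pull_ext (embed p) = fps_const 'X_i.
  have [a ax] := fps_extend_surj coef0_pull (fps_const 'X_i).
  have [|p pa] := @embed_surj i a; last by exists p; rewrite pa.
  apply: whomog_pull_ext; rewrite ax => -[|m]; last exact: whomog0.
  exact: whomogX.
have E p : embed (p \mPo mktuple s) = pull_ext (embed p).
  rewrite pull_ext_embed /comp_mpoly /mmap (raddf_sum embed).
  apply: eq_bigr => u _; apply: etrans (rmorphM embed _ _) _.
  rewrite /= [embed _%:MP]mmapC; congr (_ * _).
  rewrite /mmap1 rmorph_prod; apply: eq_bigr => j _.
  by rewrite rmorphXn tnth_mktuple /= sE.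
exists (mktuple s), (mktuple s'); split=> [i|p]; last first.
  by apply: etrans (E _) _; rewrite embed_const fps_extend_const.
have EX j : embed 'X_j = fps_const 'X_j by rewrite /embed mmapX mmap1U.
have s's j : s' j \mPo mktuple s = 'X_j.
  by apply: embed_inj; rewrite E s'E EX.
rewrite !tnth_mktuple; split=> //.
have inj : injective (comp_mpoly (mktuple s)).
  move=> p q pq; apply/embed_inj/(fps_extend_inj coef0_pull).
  exact: etrans (esym (E p)) (etrans (congr1 embed pq) (E q)).
apply: inj; rewrite comp_mpolyA comp_mpolyXU -tnth_nth tnth_mktuple.
rewrite -[RHS](comp_mpoly_id (s i)); congr (s i \mPo _).
by apply: eq_from_tnth => j; rewrite tnth_map !tnth_mktuple s's.
Qed.

End FormalFlow.

(** Both [pull f] and f + t h are killed by [transport X] and have constant term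
    f. *)
Lemma formal_deformation (K : numFieldType) n (S : zmodType) (w : 'I_n -> S)
    (X : 'I_n -> fps {mpoly K[n]}) (f h : {mpoly K[n]}) :
  (forall i, fps_whomog w (w i) (X i)) ->
  (forall i, exists D, forall m, mwt w m = w i -> (mdeg m < D)%N) ->
  transport X (fps_const f + fps_var * fps_const h) = 0 ->
  exists s s' : n.-tuple {mpoly (fps K)[n]}, mpoly_inverse s s' /\
    map_mpoly (@fps_const K) f \mPo s =
    map_mpoly (@fps_const K) f + fps_var *: map_mpoly (@fps_const K) h.
Proof.
move=> Xw bounded Xfh; have [phi phiP] := flow_exists X.
have Xphi i := (phiP i).1; have phi0 i := (phiP i).2.
have [s [s' [inv sE]]] := formal_automorphism Xw bounded Xphi phi0.
exists s, s'; split=> //; apply: embed_inj; apply: etrans (sE f) _.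
transitivity (fps_const f + fps_var * fps_const h).
  apply: (transport_uniq (transport_pull Xphi f) Xfh).
  by rewrite coef0_pull // coef_fpsD coef_fps_varM addr0.
apply/esym; apply: etrans (mmapD _ _ _ _) _; congr (_ + _).
  exact: embed_const.
apply: etrans (mmapZ _ _ _ _) _; congr (_ * _); last exact: embed_const.
apply/funext => m; rewrite /fps_map /fps_var.
exact: mpolyC_nat.
Qed.

(** * Vector fields of weight 0 and the Jacobian ideal *)

Section Ideals.
Variables (A : comNzRingType) (n : nat) (a : 'I_n -> A).

Lemma ideal_gen_gen i : ideal_gen a (a i).
Proof.
exists (fun j => (j == i)%:R); rewrite (bigD1 i) //= eqxx mul1r big1 ?addr0 //.
by move=> j /negPf ->; rewrite mul0r.
Qed.

Lemma ideal_gen0 : ideal_gen a 0.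
Proof. by exists (fun=> 0); rewrite big1 // => i _; rewrite mul0r. Qed.

Lemma ideal_genD p q : ideal_gen a p -> ideal_gen a q -> ideal_gen a (p + q).
Proof.
move=> [c ->] [c' ->]; exists (fun i => c i + c' i).
by rewrite -big_split; apply: eq_bigr => i _; rewrite mulrDl.
Qed.

Lemma ideal_genMl p q : ideal_gen a q -> ideal_gen a (p * q).
Proof.
move=> [c ->]; exists (fun i => p * c i).
by rewrite mulr_sumr; apply: eq_bigr => i _; rewrite mulrA.
Qed.

Lemma ideal_gen_sum I (r : seq I) (G : I -> A) :
  (forall i, ideal_gen a (G i)) -> ideal_gen a (\sum_(i <- r) G i).
Proof.
by move=> aG; elim/big_ind: _ => //; [exact: ideal_gen0 | exact: ideal_genD].
Qed.

End Ideals.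

Section Euler.
Variables (K : comNzRingType) (n : nat) (w : 'I_n -> K).
Implicit Types (p q : {mpoly K[n]}) (d : K).

Lemma euler d p : whomog w d p -> \sum_i w i *: ('X_i * p^`M(i)) = d *: p.
Proof.
move=> hp; rewrite [p in RHS]mpolyE scaler_sumr.
transitivity (\sum_i \sum_(m <- msupp p) (w i *+ m i * p@_m) *: 'X_[m]).
  apply: eq_bigr => i _; rewrite {1}[p]mpolyE.
  rewrite raddf_sum mulr_sumr scaler_sumr; apply: eq_bigr => m _ /=.
  rewrite mderivZ mderivX -!scalerAr !scalerA.
  have -> : w i * (p@_m * (m i)%:R) = w i *+ m i * p@_m.
    by rewrite -[w i *+ _]mulr_natr -mulrA [p@_m * _]mulrC.
  case: (eqVneq (m i) 0%N) => [->|mi]; first by rewrite mulr0n mul0r !scale0r.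
  by rewrite -mpolyXD addmC submK // lep1mP.
rewrite exchange_big !big_seq; apply: eq_bigr => m mp.
rewrite -scaler_suml -mulr_suml -/(mwt w m) (hp m) ?scalerA //.
by rewrite -mcoeff_msupp.
Qed.

End Euler.

Section HomogeneousPart.
Variables (K : comNzRingType) (n : nat) (S : zmodType) (w : 'I_n -> S).
Implicit Types (p q : {mpoly K[n]}) (d : S).

Definition wpart d p := \sum_(m <- msupp p | mwt w m == d) p@_m *: 'X_[m].

Lemma coef_wpart d p m : (wpart d p)@_m = if mwt w m == d then p@_m else 0.
Proof.
rewrite [p in RHS]mpolyE /wpart !raddf_sum big_mkcond.
case: ifP => md; last rewrite big1_seq //.
  apply: eq_bigr => u _ /=; rewrite !mcoeffZ !mcoeffX.
  by case: (eqVneq u m) => [->|_]; rewrite ?md //; case: ifP; rewrite mulr0.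
move=> u _; case: ifP => //= ud; rewrite mcoeffZ mcoeffX.
by case: (eqVneq u m) => [um|_]; rewrite ?mulr0 //; rewrite -um ud in md.
Qed.

Lemma whomog_wpart d p : whomog w d (wpart d p).
Proof. by move=> m; rewrite coef_wpart; case: (mwt w m =P d); rewrite ?eqxx. Qed.

Lemma wpart_id d p : whomog w d p -> wpart d p = p.
Proof.
move=> hp; apply/mpolyP => m; rewrite coef_wpart; case: eqP => // md.
by apply/esym/eqP; apply: contrapT => /negP /hp.
Qed.

Lemma wpart_sum d I (r : seq I) (G : I -> {mpoly K[n]}) :
  wpart d (\sum_(i <- r) G i) = \sum_(i <- r) wpart d (G i).
Proof.
apply/mpolyP => m; rewrite coef_wpart !raddf_sum /=.
under [in RHS]eq_bigr do rewrite coef_wpart.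
by case: ifP => // _; rewrite big1.
Qed.

Lemma wpartM d e p q : whomog w e q -> wpart d (p * q) = wpart (d - e) p * q.
Proof.
move=> hq; apply/mpolyP => m; rewrite coef_wpart !mcoeffM.
case: ifP => [/eqP <-|md]; last rewrite big1 //.
  apply: eq_bigr => -[u v] /= /eqP /(congr1 (mwt w)); rewrite mwtD coef_wpart => mE.
  case: (eqVneq q@_v 0) => [->|/hq ve]; first by rewrite !mulr0.
  by rewrite mE ve addrK eqxx.
move=> [u v] /= /eqP /(congr1 (mwt w)); rewrite mwtD coef_wpart => mE.
case: (eqVneq q@_v 0) => [->|/hq ve]; first by rewrite !mulr0.
by rewrite -ve eq_sym subr_eq eq_sym -mE md mul0r.
Qed.

End HomogeneousPart.

Section VectorFields.
Variables (K : numFieldType) (n : nat) (w : 'I_n -> K) (d : K).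
Variable f : {mpoly K[n]}.
Hypothesis d_neq0 : d != 0.
Hypothesis f_wh : whomog w d f.
Implicit Types (p q h : {mpoly K[n]}) (xi : 'I_n -> {mpoly K[n]}).

Definition lie xi p := \sum_i xi i * p^`M(i).

(** The directions of degree d along which the Jacobian ideal of f + t h stays
    inside that of f. *)
Definition jacobian_direction h :=
  whomog w d h /\ forall j, jacobian_ideal f h^`M(j).

(** Euler's identity writes d h as a combination of the partial derivatives of h,
    hence of those of f.  Since f and h have degree d, only the part of weight
    w i of the i-th coefficient contributes. *)
Lemma lie_exists h : jacobian_direction h ->
  exists xi, (forall i, whomog w (w i) (xi i)) /\ lie xi f = h.
Proof.
move=> [hh hJ]; have [c hE] : jacobian_ideal f h.
  have -> : h = d^-1%:MP * \sum_i w i *: ('X_i * h^`M(i)).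
    by rewrite (euler hh) mul_mpolyC scalerA mulVf // scale1r.
  apply/ideal_genMl/ideal_gen_sum => i; rewrite -mul_mpolyC.
  exact/ideal_genMl/ideal_genMl/hJ.
exists (fun i => wpart w (w i) (c i)); split=> [i|]; first exact: whomog_wpart.
rewrite /lie -[RHS](wpart_id hh) hE wpart_sum; apply: eq_bigr => i _.
by rewrite (wpartM _ _ (whomog_mderiv (i := i) f_wh)) subKr.
Qed.

Lemma lieM xi p q : lie xi (p * q) = lie xi p * q + p * lie xi q.
Proof.
rewrite mulr_suml mulr_sumr -big_split; apply: eq_bigr => i _ /=.
by rewrite mderivM mulrDr !mulrA [p * xi i]mulrC.
Qed.

Lemma lie_sum xi I (r : seq I) (G : I -> {mpoly K[n]}) :
  lie xi (\sum_(j <- r) G j) = \sum_(j <- r) lie xi (G j).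
Proof.
rewrite /lie exchange_big; apply: eq_bigr => i _ /=.
by rewrite raddf_sum mulr_sumr.
Qed.

Lemma mderiv_lie xi p j :
  (lie xi p)^`M(j) = \sum_i (xi i)^`M(j) * p^`M(i) + lie xi p^`M(j).
Proof.
rewrite raddf_sum -big_split; apply: eq_bigr => i _ /=.
by rewrite mderivM [p^`M(i)^`M(j)]mderiv_comm.
Qed.

(** Differentiating xi.f, whose Jacobian ideal is inside that of f, gives
    xi.(d_j f) = d_j (xi.f) - sum_i (d_j xi_i) d_i f, which is in the ideal. *)
Lemma lie_jacobian xi : jacobian_direction (lie xi f) ->
  forall p, jacobian_ideal f p -> jacobian_ideal f (lie xi p).
Proof.
move=> [_ xiJ] _ [c ->].
have xi_gen j : jacobian_ideal f (lie xi f^`M(j)).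
  have -> : lie xi f^`M(j) =
      (lie xi f)^`M(j) + (-1) * \sum_i (xi i)^`M(j) * f^`M(i).
    by rewrite mderiv_lie mulN1r addrAC subrr add0r.
  apply: ideal_genD; [exact: xiJ | apply: ideal_genMl]; apply: ideal_gen_sum => i.
  by apply: ideal_genMl; exact: ideal_gen_gen.
rewrite lie_sum; apply: ideal_gen_sum => i; rewrite lieM.
apply: ideal_genD; first by apply: ideal_genMl; exact: ideal_gen_gen.
by apply: ideal_genMl; exact: xi_gen.
Qed.

Lemma lie_jacobian_direction xi h : (forall i, whomog w (w i) (xi i)) ->
  jacobian_direction (lie xi f) -> jacobian_direction h -> jacobian_direction (lie xi h).
Proof.
move=> xiw xiJ [hh hJ]; split=> [|j].
  apply: whomog_sum => i _; rewrite -[d](subrK (w i)) addrC.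
  by apply: whomogM => //; exact: whomog_mderiv.
rewrite mderiv_lie; apply: ideal_genD; last exact: lie_jacobian.
by apply: ideal_gen_sum => i; apply: ideal_genMl; exact: hJ.
Qed.

Lemma jacobian_directionN h : jacobian_direction h -> jacobian_direction (- h).
Proof.
move=> [hh hJ]; split=> [|j]; first exact: whomogN.
by rewrite raddfN -mulN1r; apply: ideal_genMl; exact: hJ.
Qed.

(** With X = sum t^m xi_m, the equation X.(f + t h) = - h means xi_0.f = - h and
    xi_(m+1).f = - xi_m.h; by [lie_jacobian_direction] the right-hand sides remain
    directions to which [lie_exists] applies. *)
Lemma vector_field_exists h : jacobian_direction h ->
  exists X : 'I_n -> fps {mpoly K[n]},
    (forall i, fps_whomog w (w i) (X i)) /\
    transport X (fps_const f + fps_var * fps_const h) = 0.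
Proof.
move=> hJ.
have /choice [s sP] k : exists xi, jacobian_direction k ->
    (forall i, whomog w (w i) (xi i)) /\ lie xi f = k.
  have [kJ|nkJ] := pselect (jacobian_direction k); last by exists (fun=> 0).
  by have [xi xiP] := lie_exists kJ; exists xi.
pose xi := fix xi m := s (if m is m'.+1 then - lie (xi m') h else - h).
have xiJ m : jacobian_direction (if m is m'.+1 then - lie (xi m') h else - h).
  elim: m => [|m IH]; first exact: jacobian_directionN.
  have [xiw xif] := sP _ IH; apply: jacobian_directionN.
  by case: m => [|m] in IH xiw xif *; apply: lie_jacobian_direction => //; rewrite xif.
exists (fun i m => xi m i); split=> [i m|].
  by have [] := sP _ (xiJ m); case: m.
have xif m : lie (xi m) f = if m is m'.+1 then - lie (xi m') h else - h.
  by have [_ <-] := sP _ (xiJ m); case: m.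
have coefX (Y : fps {mpoly K[n]}) (a b : {mpoly K[n]}) m :
    (Y * (fps_const a + fps_var * fps_const b)) m =
    Y m * a + (if m is m'.+1 then Y m' * b else 0).
  rewrite mulrDr coef_fpsD [Y * _]mulrC coef_fpsCM mulrC; congr (_ + _).
  rewrite mulrCA coef_fps_varM; case: m => // m.
  by rewrite [Y * _]mulrC coef_fpsCM mulrC.
have dxE i : fps_dx i (fps_const f + fps_var * fps_const h) =
    fps_const f^`M(i) + fps_var * fps_const h^`M(i).
  apply/funext => m; rewrite /fps_dx !coef_fpsD !coef_fps_varM mderivD.
  by case: m => [|[|m]]; rewrite /= ?mderiv0.
apply/funext => m; rewrite /transport coef_fpsD coef_fps_sum coef_fps0.
under eq_bigr do rewrite dxE coefX.
rewrite /fps_dt coef_fpsD coef_fps_varM big_split /= -/(lie (xi m) f) xif add0r.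
case: m => [|m]; first by rewrite big1 // addr0 mulr1n subrr.
by rewrite mul0rn add0r addNr.
Qed.

End VectorFields.

(** * Deforming along a line *)

Lemma deformation (K : numClosedFieldType) n (w : 'I_n -> K) (d : K)
    (f h : {mpoly K[n]}) :
  d != 0 -> whomog w d f -> jacobian_direction w d f h ->
  (forall i, exists D, forall m, mwt w m = w i -> (mdeg m < D)%N) ->
  exists2 q : {poly K}, q != 0 & forall tau, q.[tau] != 0 ->
    exists r r', mpoly_inverse r r' /\ f \mPo r = f + tau *: h.
Proof.
move=> d0 fw hJ bounded; have [X [Xw Xfh]] := vector_field_exists d0 fw hJ.
have [s [s' [inv sE]]] := formal_deformation Xw bounded Xfh.
exact: specialize_automorphism (@fps_var_transcendental K) inv sE.
Qed.

(** * Weighted homogeneity of functions and of coefficients *)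

Section Digits.
Local Open Scope nat_scope.

Lemma digits_inj N n (a b : 'I_n -> nat) :
  (forall i, a i < N) -> (forall i, b i < N) ->
  \sum_i a i * N ^ i = \sum_i b i * N ^ i -> a =1 b.
Proof.
elim: n a b => [|n IH] a b aN bN; first by move=> _ [].
have N0 : 0 < N by apply: leq_ltn_trans (aN ord0).
have split_sum (c : 'I_n.+1 -> nat) : \sum_i c i * N ^ i =
    (\sum_(i < n) c (lift ord0 i) * N ^ i) * N + c ord0.
  rewrite big_ord_recl expn0 muln1 addnC big_distrl /=; congr (_ + _).
  by apply: eq_bigr => i _; rewrite -mulnA -expnSr.
rewrite !split_sum => E.
have ab0 : a ord0 = b ord0.
  by have := congr1 (modn^~ N) E; rewrite !modnMDl !modn_small.
move: E; rewrite ab0 => /addIn/eqP; rewrite eqn_pmul2r // => /eqP/IH abS i.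
by case: (unliftP ord0 i) => [j ->|-> //]; apply: abS.
Qed.

End Digits.

(** Kronecker substitution x_i := x^(N^i), with N larger than all exponents, sends
    distinct monomials to distinct powers of x and so reduces the claim to one
    variable. *)
Lemma meval_eq0 (K : numFieldType) n (p : {mpoly K[n]}) :
  (forall v, p.@[v] = 0) -> p = 0.
Proof.
move=> p0; apply/mpolyP => u; rewrite mcoeff0.
apply: contrapT => /eqP; rewrite -mcoeff_msupp => up.
pose N := msize p; pose e (m : 'X_{1..n}) := (\sum_i m i * N ^ i)%N.
have digit (m : 'X_{1..n}) i : m \in msupp p -> (m i < N)%N.
  move=> /msize_mdeg_lt; apply: leq_ltn_trans.
  by rewrite mdegE (bigD1 i) //= leq_addr.
pose P := \sum_(m <- msupp p) p@_m *: 'X^(e m) : {poly K}.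
have P0 : P = 0.
  apply: contrapT => /eqP PN0.
  have vanish x : root P x.
    apply/rootP; rewrite -[RHS](p0 (fun i => x ^+ (N ^ i))).
    rewrite mevalE horner_sum; apply: eq_bigr => m _.
    rewrite hornerZ hornerXn -prodrXr; congr (_ * _); apply: eq_bigr => i _.
    by rewrite -exprM mulnC.
  pose rs := [seq (k%:R : K) | k <- iota 0 (size P)].
  suff: (size rs < size P)%N by rewrite size_map size_iota ltnn.
  apply: max_poly_roots => //; first by apply/allP => x _; exact: vanish.
  by rewrite map_inj_uniq ?iota_uniq //; exact: mulrIn (oner_neq0 K).
have /eqP := congr1 (fun q : {poly K} => q`_(e u)) P0.
rewrite coef0 coef_sum (bigD1_seq u) ?msupp_uniq //= coefZ coefXn eqxx mulr1.
rewrite big_seq_cond big1 ?addr0 => [|m /andP[mp mu]].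
  by apply/negP; rewrite -mcoeff_msupp.
rewrite coefZ coefXn; case: eqP => [E|_]; last by rewrite mulr0.
case/eqP: mu; apply/mnmP; apply: (digits_inj (N := N)) => [i|i|].
- exact: digit.
- exact: digit.
- exact: esym E.
Qed.

Section RealWeights.
Variables (R : realType) (n : nat) (w : 'I_n -> R).
Implicit Types (f : {mpoly (Cplx R)[n]}).

Let wC i : Cplx R := (w i)%:C%C.

Lemma mwt_complex m : mwt wC m = (mwt w m)%:C%C :> Cplx R.
Proof. by rewrite /mwt rmorph_sum; apply: eq_bigr => i _; rewrite rmorphMn. Qed.

(** The single dilation by lambda = exp 1 is enough: the coefficients of
    f(lambda . x) - lambda^d f(x) vanish, and exp is injective. *)
Lemma weighted_homogeneous_whomog d f : weighted_homogeneous w d f ->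
  whomog wC (d%:C%C : Cplx R) f.
Proof.
move=> fw m fm; rewrite mwt_complex; congr (_%:C%C); apply: expR_inj.
pose c (x : R) : Cplx R := (expR x)%:C%C.
pose p : {mpoly (Cplx R)[n]} :=
  \sum_(u <- msupp f) ((c (mwt w u) - c d) * f@_u) *: 'X_[u].
have p0 : p = 0.
  apply: meval_eq0 => v; have := fw (expR 1) (\row_i v i) (expR_gt0 _).
  rewrite /mpoly_fun -expRM mul1r => /eqP; rewrite -subr_eq0 => /eqP E.
  rewrite -[RHS]E [X in _ = X - _]mevalE [X in _ = _ - _ * X]mevalE.
  rewrite raddf_sum mulr_sumr -sumrB; apply: eq_bigr => u _.
  rewrite /= mevalZ mevalX.
  have -> : \prod_i (\row_j (((expR 1 `^ w j)%:C%C : Cplx R) * (\row_k v k) ord0 j))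
      ord0 i ^+ u i = c (mwt w u) * \prod_i v i ^+ u i.
    have -> : c (mwt w u) = \prod_i ((expR 1 `^ w i)%:C%C : Cplx R) ^+ u i.
      rewrite /c /mwt expR_sum rmorph_prod; apply: eq_bigr => i _ /=.
      by rewrite -mulr_natr expRM_natr rmorphXn -expRM mul1r.
    by rewrite -big_split; apply: eq_bigr => i _; rewrite !mxE exprMn.
  have -> : \prod_i (\row_k v k) ord0 i ^+ u i = \prod_i v i ^+ u i.
    by apply: eq_bigr => i _; rewrite mxE.
  by rewrite !mulrBl !mulrA [f@_u * _]mulrC.
have /eqP := congr1 (mcoeff m) p0; rewrite mcoeff0 /p raddf_sum.
rewrite (bigD1_seq m) ?msupp_uniq ?mcoeff_msupp //= mcoeffZ mcoeffX eqxx mulr1.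
rewrite big1 ?addr0 => [|u um].
  by rewrite mulf_eq0 (negPf fm) orbF subr_eq0 => /eqP [].
by rewrite mcoeffZ mcoeffX (negPf um) mulr0.
Qed.

Hypothesis w_gt0 : forall i, 0 < w i.

Lemma mwt_bounded x : exists D, forall m, mwt wC m = x%:C%C -> (mdeg m < D)%N.
Proof.
exists (\sum_i (Num.bound (x / w i))).+1 => m; rewrite mwt_complex => -[mx].
rewrite ltnS mdegE; apply: leq_sum => i _; apply: ltnW.
have wm : w i * (m i)%:R <= x.
  rewrite -mx /mwt (bigD1 i) //= mulr_natr lerDl sumr_ge0 // => j _.
  by rewrite mulrn_wge0 // ltW.
have x0 : 0 <= x by apply: le_trans wm; rewrite mulr_ge0 // ltW.
rewrite -(ltr_nat R); apply: le_lt_trans (archi_boundP _).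
  by rewrite ler_pdivlMr // mulrC.
by rewrite divr_ge0 // ltW.
Qed.

Lemma whomog_degree0 f : mpoly_fun f 0 = 0 -> whomog wC 0 f -> f = 0.
Proof.
move=> f0 fw; have supp0 m : f@_m != 0 -> m = 0%MM.
  move=> fm; have mw : mwt w m = 0.
    by have := fw m fm; rewrite mwt_complex => -[].
  have wi_ge0 j : true -> 0 <= w j *+ m j by rewrite mulrn_wge0 // ltW.
  apply/mnmP => i; rewrite mnm0E; apply/eqP.
  have /eqP : w i *+ m i = 0 by apply: (psumr_eq0P wi_ge0 mw).
  by rewrite mulrn_eq0 (gt_eqF (w_gt0 i)) orbF.
have fE : f = (f@_0%MM)%:MP.
  apply/mpolyP => m; rewrite mcoeffC; case: (eqVneq m 0%MM) => [->|m0].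
    by rewrite mulr1.
  by rewrite mulr0; apply/eqP; apply: contraNT m0 => /supp0 ->.
by move: f0; rewrite /mpoly_fun fE mevalC => ->; rewrite mpolyC0.
Qed.

End RealWeights.

(** * Polynomial automorphisms are biholomorphic *)

Section PolynomialMaps.
Variables (R : realType) (n : nat).
Local Notation K := (Cplx R).
Implicit Types (r s : n.-tuple {mpoly K[n]}).

Definition tuple_map r (x : 'rV[K]_n) : 'rV[K]_n :=
  \row_i (tnth r i).@[x ord0].

Lemma tuple_mapK r s : (forall i, tnth s i \mPo r = 'X_i) ->
  cancel (tuple_map r) (tuple_map s).
Proof.
move=> sr x; apply/rowP => i; rewrite mxE.
rewrite -[RHS](mevalXU (x ord0)) -sr comp_mpoly_meval.
by apply: meval_eq => j; rewrite mxE.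
Qed.

Lemma differentiable_meval (p : {mpoly K[n]}) (x : 'rV[K]_n) :
  differentiable (fun y : 'rV[K]_n => p.@[y ord0]) x.
Proof.
have coordX i k : differentiable (fun y : 'rV[K]_n => y ord0 i ^+ k) x.
  elim: k => [|k IH].
    rewrite (_ : (fun _ => _) = cst 1); first exact: differentiable_cst.
    by apply/funext => y; rewrite expr0.
  rewrite (_ : (fun _ => _) =
      (fun y : 'rV[K]_n => y ord0 i : K) * (fun y => y ord0 i ^+ k)).
    by apply: differentiableM => //; exact: differentiable_coord.
  by apply/funext => y; rewrite exprS.
have monomial (m : 'X_{1..n}) l :
    differentiable (fun y : 'rV[K]_n => \prod_(i <- l) y ord0 i ^+ m i) x.
  elim: l => [|i l IH].
    rewrite (_ : (fun _ => _) = cst 1); first exact: differentiable_cst.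
    by apply/funext => y; rewrite big_nil.
  rewrite (_ : (fun _ => _) = (fun y : 'rV[K]_n => y ord0 i ^+ m i) *
      (fun y => \prod_(j <- l) y ord0 j ^+ m j)).
    exact: differentiableM.
  by apply/funext => y; rewrite big_cons.
elim/mpolyind: p => [|c m p _ _ IH].
  rewrite (_ : (fun _ => _) = cst 0); first exact: differentiable_cst.
  by apply/funext => y; rewrite meval0.
rewrite (_ : (fun _ => _) = c *: (fun y : 'rV[K]_n => \prod_i y ord0 i ^+ m i) +
    (fun y => p.@[y ord0])).
  apply: differentiableD; last exact: IH.
  apply: differentiableZ; exact: monomial.
by apply/funext => y; rewrite mevalD mevalZ mevalX.
Qed.

Lemma holomorphic_tuple_map r : holomorphic (tuple_map r).
Proof.
move=> x; rewrite (_ : tuple_map r =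
    \sum_(i < n) (fun y : 'rV[K]_n => (tnth r i).@[y ord0] *: 'e_i)).
  apply: differentiable_sum => i; apply: differentiableZl.
  exact: differentiable_meval.
apply/funext => y; rewrite fct_sumE [LHS]row_sum_delta.
by apply: eq_bigr => i _; rewrite mxE.
Qed.

Lemma right_equivalent_comp (f g : {mpoly K[n]}) r s :
  mpoly_inverse r s -> f \mPo r = g -> right_equivalent f g.
Proof.
move=> inv fr; exists (tuple_map r); split.
  split; first exact: holomorphic_tuple_map.
  exists (tuple_map s); split; first exact: holomorphic_tuple_map.
  - by apply: tuple_mapK => i; exact: (inv i).2.
  - by apply: tuple_mapK => i; exact: (inv i).1.
apply/funext => x; rewrite /mpoly_fun /= -fr comp_mpoly_meval.
by apply: meval_eq => i; rewrite mxE.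
Qed.

End PolynomialMaps.

Lemma mpoly_inverse_comp (K : comNzRingType) n (r r' s s' : n.-tuple {mpoly K[n]}) :
  mpoly_inverse r r' -> mpoly_inverse s s' ->
  mpoly_inverse (map_tuple (comp_mpoly s) r) (map_tuple (comp_mpoly r') s').
Proof.
move=> rr' ss' i; rewrite !tnth_map.
have comp_id (u v : n.-tuple {mpoly K[n]}) p : (forall j, tnth u j \mPo v = 'X_j) ->
    (p \mPo u) \mPo v = p.
  move=> uv; rewrite comp_mpolyA -[RHS]comp_mpoly_id; congr (p \mPo _).
  by apply: eq_from_tnth => j; rewrite tnth_map tnth_mktuple uv.
split; rewrite -comp_mpolyA.
  by rewrite (comp_id s s') => [|j]; [exact: (rr' i).1 | exact: (ss' j).1].
by rewrite (comp_id r' r) => [|j]; [exact: (ss' i).2 | exact: (rr' j).2].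
Qed.

Lemma mpoly_inverse_sym (K : comNzRingType) n (r r' : n.-tuple {mpoly K[n]}) :
  mpoly_inverse r r' -> mpoly_inverse r' r.
Proof. by move=> inv i; split; [exact: (inv i).2 | exact: (inv i).1]. Qed.

(** * Right equivalence *)

Lemma line_swap (K : nzRingType) (V : lmodType K) (c : K) (x y : V) :
  x + c *: (y - x) = y + (1 - c) *: (x - y).
Proof. by rewrite scalerBl scale1r addrA [y + (x - y)]addrC subrK -scalerN opprB. Qed.

Unset Implicit Arguments.

Theorem theorem2 (R : realType) (n : nat) (n_gt0 : (0 < n)%N)
  (w : 'I_n -> R) (w_gt0 : forall i, 0 < w i) (d : R)
  (f g : {mpoly (Cplx R)[n]})
  (f0 : mpoly_fun f 0 = 0) (g0 : mpoly_fun g 0 = 0)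
  (f_wh : weighted_homogeneous w d f) (g_wh : weighted_homogeneous w d g)
  (J_fg : jacobian_ideal f = jacobian_ideal g) :
  right_equivalent f g.
Proof.
have fw := weighted_homogeneous_whomog f_wh.
have gw := weighted_homogeneous_whomog g_wh.
have bounded i := mwt_bounded w_gt0 (w i).
have [d0|dN0] := eqVneq d 0.
  have zero (p : {mpoly (Cplx R)[n]}) : mpoly_fun p 0 = 0 ->
      weighted_homogeneous w d p -> p = 0.
    move=> p0 /weighted_homogeneous_whomog; rewrite d0.
    exact: whomog_degree0 w_gt0 p p0.
  rewrite (zero f f0 f_wh) (zero g g0 g_wh).
  apply: (@right_equivalent_comp _ _ _ _ [tuple 'X_i | i < n] [tuple 'X_i | i < n]).
    by move=> i; rewrite tnth_mktuple; split; exact: comp_mpoly_id.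
  by rewrite raddf0.
have dC : (d%:C%C : Cplx R) != 0.
  by apply: contraNneq dN0 => -[->].
have same (p q : {mpoly (Cplx R)[n]}) :
    jacobian_ideal p = jacobian_ideal q ->
    whomog (fun i => (w i)%:C%C : Cplx R) (d%:C%C : Cplx R) p ->
    whomog (fun i => (w i)%:C%C : Cplx R) (d%:C%C : Cplx R) q ->
    jacobian_direction (fun i => (w i)%:C%C : Cplx R) (d%:C%C : Cplx R) p (q - p).
  move=> Jpq pw qw; split=> [|j]; first exact: whomogD qw (whomogN pw).
   rewrite raddfB -mulN1r; apply: ideal_genD.
    by rewrite -/(jacobian_ideal p) Jpq; exact: ideal_gen_gen.
  by apply: ideal_genMl; exact: ideal_gen_gen.
have [q qN0 qP] := deformation dC fw (same f g J_fg fw gw) bounded.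
have [q' q'N0 q'P] := deformation dC gw (same g f (esym J_fg) gw fw) bounded.
have [tau tauP] : exists tau, ~~ root (q * (q' \Po (1 - 'X))) tau.
  apply/closed_nonrootP; apply: mulf_neq0 qN0 _.
  rewrite comp_poly2_eq0; first exact: q'N0.
  by rewrite addrC size_polyDl ?size_polyN size_polyX ?size_poly1.
move: tauP; rewrite rootE hornerM horner_comp mulf_eq0 negb_or => /andP[qt q't].
have [r [r' [rr' fr]]] := qP _ qt.
have [s [s' [ss' gs]]] := q'P _ q't.
apply: right_equivalent_comp (mpoly_inverse_comp rr' (mpoly_inverse_sym ss')) _.
rewrite -comp_mpolyA fr.
have -> : f + tau *: (g - f) = g \mPo s.
  by rewrite gs line_swap !hornerE.
rewrite comp_mpolyA -[RHS]comp_mpoly_id; congr (g \mPo _).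
by apply: eq_from_tnth => i; rewrite tnth_map tnth_mktuple; exact: (ss' i).1.
Qed.
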